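(* Let $n\ge2$ be an integer. For $1\le T\le 2-\frac1{n-1}$, we have $\lambda^{\mathcal I_{n,T}}=\gamma^{\mathcal I_{n,T}}=\alpha_{n-\lfloor \frac{1}{2-T}\rfloor}$, and for $T\ge 2-\frac1{n-1}$, $\lambda^{\mathcal I_{n,T}}=\gamma^{\mathcal I_{n,T}}=1$.
   Context: Problem (OPTiWinD on the segment): a vehicle starts at position $0$ at time $0$ and moves in $[-1,1]$ at speed at most $1$. A request is a triple $(A,[r,r+2],\delta)$ with location $A\in[-1,1]$, release time $r\ge0$ and weight $\delta>0$; it is served if the vehicle is at $A$ at some time in $[r,r+2]$. For an integer $n\ge1$ and $T\ge0$, $\mathcal I_{n,T}$ is the set of instances consisting of at most $n$ requests such that the release times of any two successive requests differ by at least $T$. An online algorithm learns each request (location and weight) only at its release time and does not know the number of requests in advance; its movement up to time $t$ depends only on the requests released up to time $t$. For an instance $I$ and algorithm $ALG$, the performance $\lambda^I_{ALG}$ is the total weight of served requests divided by the total weight of all requests; $OPT$ is the optimal offline algorithm. Define $\lambda^{\mathcal I_{n,T}}_{ALG}=\inf_{I\in\mathcal I_{n,T}}\lambda^I_{ALG}$, $\gamma^{\mathcal I_{n,T}}_{ALG}=\inf_{I\in\mathcal I_{n,T}}\lambda^I_{ALG}/\lambda^I_{OPT}$, $\lambda^{\mathcal I_{n,T}}=\sup_{ALG}\lambda^{\mathcal I_{n,T}}_{ALG}$ and $\gamma^{\mathcal I_{n,T}}=\sup_{ALG}\gamma^{\mathcal I_{n,T}}_{ALG}$, suprema over online algorithms.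 For $m\ge1$, $\alpha_m=\inf_{\delta\in(\mathbb R_{>0})^m}\max\{\frac{\delta_1}{S_2},\dots,\frac{\delta_{m-1}}{S_m},\frac{\delta_m}{S_m}\}$ where $S_i=\sum_{k=1}^i\delta_k$ (so $\alpha_1=1$). *)

(* Defs.v *)
From HB Require Import structures.
From mathcomp Require Import all_boot all_order all_algebra.
From mathcomp Require Import all_classical all_reals.

Set Implicit Arguments.
Unset Strict Implicit.
Unset Printing Implicit Defensive.

Import Order.TTheory GRing.Theory Num.Theory.
Local Open Scope classical_set_scope.
Local Open Scope ring_scope.

(* The request (A, [r, r + 2], delta). *)
Record request (R : realType) := Request {
  location : R;
  release : R;
  weight : R }.

Section OPTiWinD.
Variable R : realType.
Implicit Types (q : request R) (I J : seq (request R)) (x : R -> R).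

Definition valid_request q : bool :=
  [&& -1 <= location q <= 1, 0 <= release q & 0 < weight q].

(* Requests are listed in the order of their release. *)
Definition instance I : bool :=
  all valid_request I && sorted (fun p q => release p <= release q) I.

(* Empty instances are excluded: their performance would be 0 / 0. *)
Definition instances (n : nat) (T : R) : set (seq (request R)) :=
  [set I | [/\ instance I, (0 < size I <= n)%N
             & sorted (fun p q => T <= release q - release p) I]].

(* Only the values of a trajectory at times t >= 0 are meaningful. *)
Definition trajectory x : Prop :=
  [/\ x 0 = 0,
      forall t, 0 <= t -> -1 <= x t <= 1
    & forall s t, 0 <= s -> 0 <= t -> `|x t - x s| <= `|t - s|].

Definition served x q : Prop :=
  exists t, release q <= t <= release q + 2 /\ x t = location q.

Definition released (t : R) I : seq (request R) :=
  [seq q <- I | release q <= t].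

(* A deterministic online algorithm maps every instance to a trajectory whose
   restriction to [0, t] is determined by the requests released up to t. *)
Definition online (ALG : seq (request R) -> R -> R) : Prop :=
  (forall I, instance I -> trajectory (ALG I)) /\
  (forall I J t, instance I -> instance J -> released t I = released t J ->
     forall s, 0 <= s <= t -> ALG I s = ALG J s).

Definition performance x I : R :=
  (\sum_(q <- I | `[< served x q >]) weight q) / (\sum_(q <- I) weight q).

(* The supremum is a maximum: for a given I the performance takes only
   finitely many values. *)
Definition performance_OPT I : R :=
  sup [set performance x I | x in trajectory].

Definition lambda_ALG ALG (n : nat) (T : R) : R :=
  inf [set performance (ALG I) I | I in instances n T].

Definition gamma_ALG ALG (n : nat) (T : R) : R :=
  inf [set performance (ALG I) I / performance_OPT I | I in instances n T].

Definition lambda (n : nat) (T : R) : R :=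
  sup [set lambda_ALG ALG n T | ALG in online].

Definition gamma (n : nat) (T : R) : R :=
  sup [set gamma_ALG ALG n T | ALG in online].

(* With indices shifted to start from 0, d`_i is delta_(i+1), while
   psum d i is S_i = delta_1 + ... + delta_i. *)
Definition psum (d : seq R) (i : nat) : R := \sum_(k < i) d`_k.

Definition alpha_max (m : nat) (d : m.-tuple R) : R :=
  \big[Num.max/d`_m.-1 / psum d m]_(i < m.-1) (d`_i / psum d i.+2).

(* Meaningful for m >= 1. *)
Definition alpha (m : nat) : R :=
  inf [set alpha_max d | d in [set d : m.-tuple R | all (fun a => 0 < a) d]].

End OPTiWinD.

Arguments alpha : clear implicits.

(* Main.v *)
Require Import Defs.
From mathcomp Require Import all_boot all_order all_algebra.
From mathcomp Require Import all_classical all_reals.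
From mathcomp Require Import zify ring lra.
Import Order.TTheory GRing.Theory Num.Theory.
Local Open Scope ring_scope.

(** Let [s = 2 - T] and [k] be the integer part of [1 / s].

    Lower bound.  The vehicle goes straight to its target and then back toward the
    center.  Its distance to the center grows by at most [s] per request, so that
    each of the first [k] requests is served before the next one is released.
    Later, a request released while another one of weight [v] is pending is
    ignored if [V + v >= alpha * (total released weight)], where [V] is the weight
    already secured; otherwise it replaces the pending one.  The weights pending
    since the last time a request was ignored then form a sequence of length at
    most [n - k], and if the algorithm were below the ratio [alpha] at the end,
    all the quotients in the definition of [alpha] for this sequence would be
    smaller than [alpha].

    Upper bound.  Requests alternate between the endpoints.  The first [k] of them,
    of negligible and quickly growing weights, are each released after the previous
    one is served and push the vehicle to distance [k * s] from the center.  As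
    [1 + k * s > T], the next request can only be served more than [T] after its
    release, and from then on a request is released just before the previous one
    is reached.  The vehicle can serve only one of these two, whereas an offline
    vehicle serves all but the first [k] requests, since the releases are almost
    [2] apart. *)

Set Implicit Arguments.
Unset Strict Implicit.
Unset Printing Implicit Defensive.

(** * Trajectories *)

Section Motion.
Variable R : realType.
Implicit Types (x y : R -> R) (q : request R).

Lemma trajectory_lip x s t : trajectory x -> 0 <= s -> s <= t ->
  x s - (t - s) <= x t <= x s + (t - s).
Proof.
move=> [_ _ lip] s0 st; have t0 : 0 <= t by lra.
by have := lip s t s0 t0; rewrite (ger0_norm (_ : 0 <= t - s)) ?subr_ge0// ler_distl.
Qed.

Lemma trajectory_bound x t : trajectory x -> 0 <= t -> -1 <= x t <= 1.
Proof. by move=> [_ + _]; apply. Qed.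

Lemma trajectory_intro x : x 0 = 0 -> (forall t, 0 <= t -> -1 <= x t <= 1) ->
  (forall s t, 0 <= s -> s <= t -> x s - (t - s) <= x t <= x s + (t - s)) ->
  trajectory x.
Proof.
move=> x0 xb lip; split=> // s t s0 t0; case: (leP s t) => [st|/ltW ts].
  by rewrite (ger0_norm (_ : 0 <= t - s)) ?subr_ge0// ler_distl lip.
by rewrite distrC (distrC t) (ger0_norm (_ : 0 <= s - t)) ?subr_ge0// ler_distl lip.
Qed.

(** [A] clamped to [[p - d, p + d]]: the position reached from [p] by heading for [A] at full speed
    during a time [d]. *)
Definition move (p A d : R) : R := Num.max (p - d) (Num.min (p + d) A).

Lemma move_cases p A d : 0 <= d ->
  [\/ move p A d = A /\ p - d <= A <= p + d,
      move p A d = p + d /\ p + d <= A | move p A d = p - d /\ A <= p - d].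
Proof.
move=> d0; rewrite /move; case: (leP (p + d) A) => h1.
  by apply: Or32; split=> //; rewrite max_r//; lra.
case: (leP (p - d) A) => h2; first by apply: Or31; split=> //; lra.
by apply: Or33; split=> //; lra.
Qed.

Definition headTo x r A t : R := if t <= r then x t else move (x r) A (t - r).

Lemma headTo_before x r A t : t <= r -> headTo x r A t = x t.
Proof. by rewrite /headTo => ->. Qed.

Lemma headTo_after x r A t : r <= t -> headTo x r A t = move (x r) A (t - r).
Proof.
move=> rt; rewrite /headTo; case: ifP => // tr.
have -> : t = r by lra.
by have [|[]|[]|[]] := @move_cases (x r) A (r - r); lra.
Qed.

Lemma headTo_trajectory x r A : trajectory x -> 0 <= r -> -1 <= A <= 1 ->
  trajectory (headTo x r A).
Proof.
move=> xT r0 Ab; have xr := trajectory_bound xT r0.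
have aft t : r <= t -> x r - (t - r) <= headTo x r A t <= x r + (t - r) /\
    -1 <= headTo x r A t <= 1.
  move=> rt; rewrite headTo_after//.
  by have [|[]|[]|[]] := @move_cases (x r) A (t - r); lra.
apply: trajectory_intro.
- by rewrite headTo_before//; case: xT.
- move=> t t0; case: (leP t r) => [tr|/ltW rt]; last by have [] := aft _ rt.
  by rewrite headTo_before//; exact: trajectory_bound.
move=> s t s0 st; case: (leP t r) => [tr|/ltW rt].
  rewrite !headTo_before//; last lra.
  exact: trajectory_lip.
case: (leP s r) => [sr|/ltW rs].
  rewrite (headTo_before _ _ sr).
  have [+ _] := aft _ rt; have := trajectory_lip xT s0 sr; lra.
rewrite !headTo_after//.
have [|[]|[]|[]] := @move_cases (x r) A (t - r); first lra;
have [|[]|[]|[]] := @move_cases (x r) A (s - r); lra.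
Qed.

Lemma headTo_reach x r A t : r + `|A - x r| <= t -> headTo x r A t = A.
Proof.
move=> rt; have := ler_norm (A - x r); have := ler_norm (x r - A).
rewrite distrC => h1 h2; have n0 := normr_ge0 (A - x r).
rewrite headTo_after; last lra.
by have [|[]|[]|[]] := @move_cases (x r) A (t - r); lra.
Qed.

Lemma static_trajectory : trajectory (fun _ : R => 0).
Proof. by apply: trajectory_intro => //= *; rewrite ?lexx ?lerN10 ?ler01//; lra. Qed.

(** Unlike [served], this depends only on the route up to time [u], so that it survives later
    changes of route. *)
Definition served_by x (u : R) q : Prop :=
  exists t, [/\ release q <= t <= release q + 2, t <= u & x t = location q].

Lemma served_by_served x u q : served_by x u q -> served x q.
Proof. by case=> t [h1 _ h2]; exists t. Qed.

Lemma served_by_mono x y u u' q : u <= u' -> (forall t, 0 <= t -> t <= u -> x t = y t) ->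
  0 <= release q -> served_by x u q -> served_by y u' q.
Proof.
move=> uu' xy q0 [t [h1 h2 h3]]; exists t; split=> //; first lra.
by rewrite -xy//; lra.
Qed.

End Motion.

(** * Weights of lists of requests *)

Section Sums.
Variable R : realType.
Implicit Types (q : request R) (I J : seq (request R)).

Definition total_weight I : R := \sum_(q <- I) weight q.

Definition gain (P : request R -> Prop) I : R := \sum_(q <- I | `[< P q >]) weight q.

Lemma performanceE x I : performance x I = gain (served x) I / total_weight I.
Proof. by []. Qed.

Lemma total_weight_cons q I : total_weight (q :: I) = weight q + total_weight I.
Proof. by rewrite /total_weight big_cons. Qed.

Lemma total_weight_cat I J : total_weight (I ++ J) = total_weight I + total_weight J.
Proof. by rewrite /total_weight big_cat. Qed.

Lemma total_weight_rcons I q : total_weight (rcons I q) = total_weight I + weight q.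
Proof. by rewrite -cats1 total_weight_cat total_weight_cons /total_weight big_nil addr0. Qed.

Lemma gain_cons_in (P : request R -> Prop) q I : P q -> gain P (q :: I) = weight q + gain P I.
Proof. by move=> Pq; rewrite /gain big_cons; case: asboolP. Qed.

Lemma gain_cons_out (P : request R -> Prop) q I : ~ P q -> gain P (q :: I) = gain P I.
Proof. by move=> Pq; rewrite /gain big_cons; case: asboolP. Qed.

Lemma gain_cat P I J : gain P (I ++ J) = gain P I + gain P J.
Proof. by rewrite /gain big_cat. Qed.

Lemma valid_weight q : valid_request q -> 0 < weight q.
Proof. by case/and3P. Qed.

Lemma valid_release q : valid_request q -> 0 <= release q.
Proof. by case/and3P. Qed.

Lemma valid_location q : valid_request q -> -1 <= location q <= 1.
Proof. by case/and3P. Qed.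

Lemma gain_ge0 P I : all (@valid_request R) I -> 0 <= gain P I.
Proof.
elim: I => [|q I IH] /=; first by rewrite /gain big_nil.
move=> /andP[/valid_weight q0 /IH]; have [Pq|Pq] := pselect (P q).
  by rewrite gain_cons_in//; lra.
by rewrite gain_cons_out.
Qed.

Lemma gain_cons_ge P q J : 0 < weight q -> gain P J <= gain P (q :: J).
Proof.
move=> q0; have [Pq|Pq] := pselect (P q).
  by rewrite gain_cons_in//; lra.
by rewrite gain_cons_out.
Qed.

Lemma gain_mono P Q I : all (@valid_request R) I ->
  (forall q, valid_request q -> P q -> Q q) -> gain P I <= gain Q I.
Proof.
move=> + PQ; elim: I => [|q I IH] /=; first by rewrite /gain !big_nil.
move=> /andP[vq /IH]; have q0 := valid_weight vq.
have [Pq|Pq] := pselect (P q).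
  by rewrite !gain_cons_in//; [lra | exact: PQ].
rewrite (gain_cons_out _ Pq).
have [Qq|Qq] := pselect (Q q); first by rewrite gain_cons_in//; lra.
by rewrite gain_cons_out.
Qed.

Lemma gain_le_total_weight P I : all (@valid_request R) I -> gain P I <= total_weight I.
Proof.
elim: I => [|q I IH] /=; first by rewrite /gain /total_weight !big_nil.
move=> /andP[/valid_weight q0 /IH]; rewrite total_weight_cons.
have [Pq|Pq] := pselect (P q); first by rewrite gain_cons_in//; lra.
by rewrite gain_cons_out//; lra.
Qed.

Lemma gain_rev P I : gain P (rev I) = gain P I.
Proof.
elim: I => // q I IH; rewrite rev_cons -cats1 gain_cat IH addrC -gain_cat.
by rewrite cat1s.
Qed.

Lemma total_weight_rev I : total_weight (rev I) = total_weight I.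
Proof. by elim: I => // q I IH; rewrite rev_cons total_weight_rcons IH addrC total_weight_cons. Qed.

Lemma total_weight_gt0 I : all (@valid_request R) I -> (0 < size I)%N -> 0 < total_weight I.
Proof.
case: I => //= q I /andP[/valid_weight q0 vI] _; rewrite total_weight_cons.
by have := @gain_le_total_weight (fun=> True) _ vI; have := gain_ge0 (fun=> True) vI; lra.
Qed.

Lemma gain_rcons P I q : gain P (rcons I q) = gain P I + gain P [:: q].
Proof. by rewrite -cats1 gain_cat. Qed.

Lemma gain1_in (P : request R -> Prop) q : P q -> gain P [:: q] = weight q.
Proof. by move=> Pq; rewrite gain_cons_in// /gain big_nil addr0. Qed.

Lemma gain1_out (P : request R -> Prop) q : ~ P q -> gain P [:: q] = 0.
Proof. by move=> Pq; rewrite gain_cons_out// /gain big_nil. Qed.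

End Sums.

(** * The online algorithm *)

Section Algorithm.
Variable R : realType.
Variables (k : nat) (a : R).
Implicit Types (x y : R -> R) (q : request R) (I J : seq (request R)).

Definition plan x q : R -> R :=
  headTo (headTo x (release q) (location q))
    (release q + `|location q - x (release q)|) 0.

Lemma plan_before x q t : t <= release q -> plan x q t = x t.
Proof.
move=> tq; have := normr_ge0 (location q - x (release q)) => n0.
by rewrite /plan !headTo_before//; lra.
Qed.

Lemma plan_at x q :
  plan x q (release q + `|location q - x (release q)|) = location q.
Proof. by rewrite /plan headTo_before// headTo_reach. Qed.

Lemma plan_trajectory x q : trajectory x -> valid_request q -> trajectory (plan x q).
Proof.
move=> xT /and3P[lq rq _]; apply: headTo_trajectory; last by rewrite lerN10 ler01.
  exact: headTo_trajectory.
by rewrite addr_ge0.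
Qed.

(** The request lies at distance at most 1 from the center, to which the vehicle returns at full
    speed after its arrival. *)
Lemma plan_near_0 x q t : -1 <= location q <= 1 ->
  release q + `|location q - x (release q)| <= t ->
  `|plan x q t| <= Num.max 0 (1 + release q + `|location q - x (release q)| - t).
Proof.
set d := `|_|; set p := release q + d => lq pt.
have pE : p = release q + d by [].
rewrite le_max /plan headTo_after// headTo_reach// -/d -/p.
have [|[-> _]|[-> h]|[-> h]] := @move_cases R (location q) 0 (t - p); first lra.
- by rewrite normr0 lexx.
- by apply/orP; right; rewrite ler_norml; lra.
by apply/orP; right; rewrite ler_norml; lra.
Qed.

(** [secured] stands for weight that no later change of route can lose, [pending] for the weight of
    the latest request as long as another one may still replace it. *)
Record state := State { route : R -> R ; secured : R ; pending : R }.

(* The requests are listed from the latest to the earliest. *)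
Fixpoint run J : state :=
  if J is q :: J' then
    let: State x V v := run J' in
    if (size J' < k)%N then State (plan x q) (V + weight q) 0
    else if a * total_weight J <= V + v then State x (V + v) 0
    else State (plan x q) V (weight q)
  else State (fun=> 0) 0 0.

Definition algorithm I : R -> R := route (run (rev I)).

Lemma run_trajectory J : all (@valid_request R) J -> trajectory (route (run J)).
Proof.
elim: J => [_|q J IH] /=; first exact: static_trajectory.
case/andP => vq /IH; case: (run J) => x V v /= xT.
by do 2?[case: ifP => // _]; exact: plan_trajectory.
Qed.

Lemma run_before q J t : t <= release q -> route (run (q :: J)) t = route (run J) t.
Proof.
move=> tq /=; case: (run J) => x V v.
case: ifP => _ /=; first by rewrite plan_before.
by case: ifP => _ //=; rewrite plan_before.
Qed.

(** The requests released after [t] are at the head of the list, and by [run_before] each leaves the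
    route unchanged up to its release. *)
Lemma run_released J t s : sorted (fun p q : request R => release q <= release p) J ->
  s <= t -> route (run J) s = route (run [seq q <- J | release q <= t]) s.
Proof.
move=> + st; elim: J => // q J IH /[dup] sqJ /path_sorted sJ.
have -> : [seq p <- q :: J | release p <= t] = if release q <= t then
    q :: [seq p <- J | release p <= t] else [seq p <- J | release p <= t] by [].
case: ifP => [qt|/negbT]; last first.
  by rewrite -ltNge => tq; rewrite run_before ?IH//; lra.
rewrite (all_filterP (_ : all (fun p => release p <= t) J))//.
have := order_path_min _ sqJ; rewrite /transitive.
move=> /(_ (fun p q r h1 h2 => le_trans h2 h1)).
by apply: sub_all => p pq; lra.
Qed.

Lemma algorithm_online : online algorithm.
Proof.
split=> [I /andP[vI _]|I J t iI iJ IJ s /andP[_ st]].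
  by apply: run_trajectory; rewrite all_rev.
have E K : instance K -> algorithm K s = route (run (rev (released t K))) s.
  move=> /andP[_ sK]; rewrite /algorithm (@run_released _ t)//; last by rewrite rev_sorted.
  by rewrite filter_rev.
by rewrite !E// IJ.
Qed.

(** * Distance to the center and served weight *)

Section Geometry.
Variable T : R.

(* The convention [- T] makes every nonnegative release time admissible for a
   first request. *)
Definition last_release J : R := if J is q :: _ then release q else - T.

Fixpoint spaced J : bool :=
  if J is q :: J' then [&& valid_request q, T <= release q - last_release J' & spaced J']
  else true.

Lemma spaced_valid J : spaced J -> all (@valid_request R) J.
Proof. by elim: J => //= q J IH /and3P[-> _ /IH]. Qed.

Lemma last_release_geN J : 1 <= T -> spaced J -> - T <= last_release J.
Proof.
by case: J => [_ _|q J T1 /and3P[/valid_release + _ _]] /=; [rewrite lexx|lra].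
Qed.

(** The next release is at [r + T] or later, so that weight gained by then is safe. In the second
    case [q] is pending: [V] was gained among the earlier requests by its release, and [q] will be
    reached if the route is kept. *)
Definition secure J (S : state) : Prop :=
  let: State x V v := S in let r := last_release J in
  (v = 0 /\ V <= gain (served_by x (r + T)) J) \/
  (if J is q :: J' then
     [/\ v = weight q, V <= gain (served_by x r) J' & served_by x (r + 2) q]
   else False).

Definition central J (S : state) : Prop :=
  pending S = 0 /\
  forall t, last_release J + T <= t -> `|route S t| <= (size J)%:R * (2 - T).

Lemma gain_served_by_mono x y (u u' : R) J : all (@valid_request R) J ->
  u <= u' -> (forall t, 0 <= t -> t <= u -> x t = y t) ->
  gain (served_by x u) J <= gain (served_by y u') J.
Proof.
move=> vJ uu xy; apply: gain_mono => // q /valid_release q0.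
exact: served_by_mono.
Qed.

(** The segment has length 2, so every target is reached within its window. For the first [k]
    requests, a vehicle within [i * (2 - T)] of the center needs at most [1 + i * (2 - T) <= T] to
    arrive, and at time [T] after the release it is back within [(i + 1) * (2 - T)]. *)
Lemma run_invariant J : 1 <= T <= 2 -> k%:R * (2 - T) <= 1 -> spaced J ->
  secure J (run J) /\ ((size J <= k)%N -> central J (run J)).
Proof.
move=> /andP[T_ge1 T_le2] kT; elim: J => [_|q J IH].
  split=> [|_]; first by left; rewrite /gain big_nil.
  by split=> //= t _; rewrite normr0 mul0r.
move=> /[dup] spq /= /and3P[vq gap /[dup] spJ /IH {IH}].
have xT := run_trajectory (spaced_valid spJ); have rJ := last_release_geN T_ge1 spJ.
have vJ := spaced_valid spJ.
case: (run J) xT => x V v /= xT [inv cen].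
have q0 := valid_weight vq; have r0 := valid_release vq; have lq := valid_location vq.
set r := release q in gap r0 *.
have xr := trajectory_bound xT r0.
have agree t : 0 <= t -> t <= r -> x t = plan x q t.
  by move=> _ tr; rewrite plan_before.
have dist (e : R) : `|x r| <= e -> `|location q - x r| <= 1 + e.
  by rewrite !ler_norml => xe; lra.
have dist2 : `|location q - x r| <= 2 by rewrite ler_norml; lra.
have dist0 := normr_ge0 (location q - x r).
have reach u : r + `|location q - x r| <= u -> served_by (plan x q) u q.
  move=> ru; exists (r + `|location q - x r|).
  by split=> //; [rewrite -/r; lra | exact: plan_at].
case: ifPn => [Jk|]; last rewrite -leqNgt => Jk.
  have [/= v0 pos] := cen (ltnW Jk).
  have size_le : (size J).+1%:R * (2 - T) <= 1.
    apply: le_trans kT; apply: ler_wpM2r; first lra.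
    by rewrite ler_nat.
  have Hx : `|x r| <= (size J)%:R * (2 - T) by apply: pos; lra.
  have Hd := dist _ Hx.
  rewrite -natr1 in size_le.
  have served_q : served_by (plan x q) (r + T) q by apply: reach; nra.
  split.
    left; split=> //; rewrite gain_cons_in// addrC lerD2l.
    (* [central] gives [v = 0], whereas a pending request would have positive weight. *)
    have {inv} : V <= gain (served_by x (last_release J + T)) J.
      case: inv => [[_ //]|]; case: (J) v0 vJ => //= p J' -> /andP[/valid_weight p0 _].
      by case; lra.
    move=> h; apply: (le_trans h).
    apply: (@le_trans _ _ (gain (served_by (plan x q) r) J)).
      apply: gain_served_by_mono => //; first lra.
      by move=> t t0 h'; apply: agree => //; lra.
    by apply: gain_served_by_mono => //=; rewrite -/r; lra.
  move=> _; split=> // t; rewrite [last_release _]/= -/r => rt.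
  have := @plan_near_0 x q t lq; rewrite -/r => /(_ _)/le_trans; apply; first nra.
  rewrite [size _]/= ge_max -natr1; apply/andP; split; last by rewrite mulrDl mul1r; lra.
  by apply: mulr_ge0; [rewrite addr_ge0|lra].
split; last by [].
case: ifPn => [acc|rej] /=.
  left; split=> //; case: inv => [[-> h]|].
    rewrite addr0; apply: (le_trans h); apply: le_trans (gain_cons_ge _ _ q0).
    by apply: gain_served_by_mono => //=; rewrite -/r; lra.
  (* The pending [p] is served by [release p + 2], which is at most [r + T] because
     [r >= release p + T] and [T >= 1]. *)
  case: (J) vJ gap => //= p J' /andP[vp vJ'] gap [-> h1 h2].
  have p0 := valid_weight vp; have := valid_release vp => pr.
  apply: le_trans (gain_cons_ge _ _ q0).
  rewrite gain_cons_in; last by apply: served_by_mono h2 => //=; rewrite -/r; lra.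
  rewrite addrC lerD2l; apply: (le_trans h1).
  by apply: gain_served_by_mono => //=; rewrite -/r; lra.
right; rewrite -/r; split=> //; last by apply: reach; lra.
case: inv => [[_ h]|].
  apply: (le_trans h); apply: gain_served_by_mono => //; first lra.
  by move=> t t0 h'; apply: agree => //; lra.
case: (J) vJ gap => //= p J' /andP[vp vJ'] gap [_ h1 h2].
have p0 := valid_weight vp.
apply: (le_trans h1); apply: le_trans (gain_cons_ge _ _ p0).
apply: gain_served_by_mono => //; first lra.
by move=> t t0 h'; apply: agree => //; lra.
Qed.

Lemma run_gain J : 1 <= T <= 2 -> k%:R * (2 - T) <= 1 -> spaced J ->
  secured (run J) + pending (run J) <= gain (served (route (run J))) J.
Proof.
move=> Tb kT spJ; have [+ _] := run_invariant Tb kT spJ; have vJ := spaced_valid spJ.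
have sub x (u : R) K : all (@valid_request R) K ->
    gain (served_by x u) K <= gain (served x) K.
  by move=> vK; apply: gain_mono => // q _; exact: served_by_served.
case: (run J) => x V v /= [[-> h]|].
  by rewrite addr0; apply: (le_trans h); exact: sub.
case: J vJ {spJ} => //= q J /andP[vq vJ] [-> h1 h2].
rewrite gain_cons_in; last exact: served_by_served h2.
by rewrite addrC lerD2l; apply: (le_trans h1); exact: sub.
Qed.

Lemma instances_spaced n I : 1 <= T -> instances n T I -> spaced (rev I).
Proof.
move=> T_ge1 [/andP[vI _] _ sI].
have : sorted (fun p q => T <= release p - release q) (rev I) by rewrite rev_sorted.
have : all (@valid_request R) (rev I) by rewrite all_rev.
elim: (rev I) => //= q [|p J] IH /=.
  by case/andP => /[dup] /valid_release q0 -> _ _; rewrite andbT; lra.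
case/and3P => -> vp vJ /andP[-> pJ] /=.
by apply: IH => //=; rewrite vp.
Qed.

End Geometry.

End Algorithm.

(** * The constants alpha *)

Section Alpha.
Variable R : realType.
Implicit Types (c : seq R) (i m : nat).

Let positive c := all (fun a => 0 < a) c.

Lemma psumS c i : psum c i.+1 = psum c i + c`_i.
Proof. by rewrite /psum big_ord_recr. Qed.

Lemma psum0 c : psum c 0 = 0.
Proof. by rewrite /psum big_ord0. Qed.

Lemma psum_cons e c i : psum (e :: c) i.+1 = e + psum c i.
Proof. by rewrite /psum big_ord_recl. Qed.

Lemma psum_rcons c e i : (i <= size c)%N -> psum (rcons c e) i = psum c i.
Proof.
move=> ic; apply: eq_bigr => -[j /= ji] _.
by rewrite nth_rcons (leq_trans ji ic).
Qed.

Lemma nth_gt0 c i : positive c -> (i < size c)%N -> 0 < c`_i.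
Proof. by move=> /all_nthP; apply. Qed.

Lemma nth_ge0 c i : positive c -> 0 <= c`_i.
Proof.
move=> pc; have [ic|ci] := ltnP i (size c); first exact/ltW/nth_gt0.
by rewrite nth_default.
Qed.

Lemma psum_ge0 c i : positive c -> 0 <= psum c i.
Proof. by move=> pc; apply: sumr_ge0 => j _; exact: nth_ge0. Qed.

Lemma psum_gt0 c i : positive c -> (0 < size c)%N -> 0 < psum c i.+1.
Proof.
case: c => // e c pc _; rewrite psum_cons.
have e0 : 0 < e by case/andP: pc.
by have /(@psum_ge0 _ i) : positive c; [case/andP: pc|lra].
Qed.

Lemma alpha_max_ge_last m (d : m.-tuple R) : d`_m.-1 / psum d m <= alpha_max d.
Proof. exact: bigmax_ge_id. Qed.

Lemma alpha_max_ge m (d : m.-tuple R) i : (i < m.-1)%N -> d`_i / psum d i.+2 <= alpha_max d.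
Proof. by move=> im; exact: (le_bigmax _ _ (Ordinal im)). Qed.

Lemma alpha_max_gt0 m (d : m.+1.-tuple R) : positive d -> 0 < alpha_max d.
Proof.
move=> pd; apply: lt_le_trans (alpha_max_ge_last d).
by apply: divr_gt0; [apply: nth_gt0|apply: psum_gt0]; rewrite // size_tuple.
Qed.

Lemma alpha_max_ge0 m (d : m.-tuple R) : positive d -> 0 <= alpha_max d.
Proof.
move=> pd; apply: le_trans (alpha_max_ge_last d).
by rewrite divr_ge0// ?nth_ge0// psum_ge0.
Qed.

Lemma alpha_lbound m :
  has_lbound [set alpha_max d | d in [set d : m.-tuple R | all (fun a => 0 < a) d]]%classic.
Proof. by exists 0 => _ [d /= pd <-]; exact: alpha_max_ge0. Qed.

Lemma alpha_nonempty m :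
  ([set alpha_max d | d in [set d : m.-tuple R | all (fun a => 0 < a) d]] !=set0)%classic.
Proof.
exists (alpha_max [tuple of nseq m (1 : R)]), [tuple of nseq m (1 : R)] => //.
by rewrite /mkset all_nseq ltr01 orbT.
Qed.

Lemma alpha_le_max m (d : m.-tuple R) : positive d -> alpha R m <= alpha_max d.
Proof. by move=> pd; apply: (ge_inf (@alpha_lbound m)); exists d. Qed.

Lemma alpha_ge0 m : 0 <= alpha R m.
Proof. by apply: lb_le_inf (alpha_nonempty m) _ => _ [d /= pd <-]; exact: alpha_max_ge0. Qed.

Lemma alpha_le1 m : alpha R m.+1 <= 1.
Proof.
pose d := [tuple of nseq m.+1 (1 : R)].
have pd : positive d by rewrite /positive all_nseq ltr01 orbT.
have ps i : 0 < psum d i.+1 by apply: psum_gt0; rewrite // size_tuple.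
apply: (le_trans (alpha_le_max pd)); apply: bigmax_le => [|i _].
  by rewrite ler_pdivrMr// mul1r psumS lerDr psum_ge0.
by rewrite ler_pdivrMr// mul1r 2!psumS -addrA addrCA lerDl addr_ge0 ?psum_ge0 ?nth_ge0.
Qed.

(* A tiny first weight hardly changes the other ratios, and its own ratio is tiny. *)
Lemma alphaS m : alpha R m.+2 <= alpha R m.+1.
Proof.
apply: lb_le_inf (alpha_nonempty _) _ => _ [d /= pd <-].
have d0 : 0 < d`_0 by apply: nth_gt0; rewrite // size_tuple.
have b0 := alpha_max_gt0 pd; set b := alpha_max d in b0 *.
have e0 : 0 < b * d`_0 by exact: mulr_gt0.
(* The new first ratio is [b / (b + 1) <= b], and the other ratios only shrink as their denominators
   grow. *)
pose d' := [tuple of b * d`_0 :: d].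
have pd' : positive d' by rewrite /= e0.
have ps i : 0 < psum d i.+1 by apply: psum_gt0; rewrite // size_tuple.
have shrink x i : 0 <= x -> x / (b * d`_0 + psum d i.+1) <= x / psum d i.+1.
  move=> x0; apply: ler_wpM2l => //; have := ps i => p0.
  by rewrite lef_pV2// ?posrE; lra.
apply: (le_trans (alpha_le_max pd')); apply: bigmax_le => [|[i /= im] _].
  rewrite psum_cons; apply: le_trans (alpha_max_ge_last d).
  by apply: shrink; exact: nth_ge0.
rewrite psum_cons; case: i im => [|i] im.
  rewrite ler_pdivrMr; last by have := ps 0%N; lra.
  by rewrite psumS psum0 add0r /=; nra.
apply: (@le_trans _ _ (d`_i / psum d i.+2)); last exact: alpha_max_ge.
by apply: shrink; exact: nth_ge0.
Qed.

Lemma alpha_antitone l m : (l <= m)%N -> alpha R m.+1 <= alpha R l.+1.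
Proof.
move=> /subnK <-; elim: (m - l)%N => // i IH.
by rewrite addSn; exact: le_trans (alphaS _) IH.
Qed.

(** Otherwise all quotients for [c] would be below [alpha R m.+1], which is at most [alpha R l.+1],
    the infimum of their maximum. *)
Lemma alpha_attained c l m : positive c -> size c = l.+1 -> (l <= m)%N ->
  (forall i, (i < l)%N -> c`_i < alpha R m.+1 * psum c i.+2) ->
  alpha R m.+1 * psum c l.+1 <= c`_l.
Proof.
move=> pc sc lm H; rewrite leNgt; apply/negP => Hl.
have sc' : size c == l.+1 by apply/eqP.
have := alpha_le_max (d := Tuple sc') pc; apply/negP; rewrite -ltNge.
apply: lt_le_trans (alpha_antitone lm).
have ps i : 0 < psum c i.+1 by apply: psum_gt0; rewrite // sc.
apply: bigmax_lt => [|[i /= im] _]; first by rewrite /= ltr_pdivrMr.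
by rewrite ltr_pdivrMr//; exact: H.
Qed.

End Alpha.

(** * The ratio guaranteed by the algorithm *)

Section Lower.
Variable R : realType.
Implicit Types (I J : seq (request R)).

(* [W] is the total weight up to the last decision to keep the current route and
   [c] lists the weights since then, each of which, except the last, was dropped. *)
Lemma run_chain (k : nat) (a : R) J : all (@valid_request R) J -> a <= 1 ->
  let: State _ V v := run k a J in
  exists (W : R) (c : seq R), [/\ all (fun x => 0 < x) c /\ (size c <= size J - k)%N,
    total_weight J = W + psum c (size c), a * W <= V, v = last 0 c &
    forall i, (i.+1 < size c)%N -> V + c`_i < a * (W + psum c i.+2)].
Proof.
move=> + a1; elim: J => [_|q J IH] /=.
  exists 0, [::]; split=> //=; last by rewrite mulr0.
  by rewrite psum0 /total_weight big_nil addr0.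
case/andP => /valid_weight q0 /IH {IH}; case: (run k a J) => x V v.
case=> W [c [[pc sc] tot Wa vE drop]]; rewrite total_weight_cons.
case: ifPn => [Jk|]; last rewrite -leqNgt => Jk.
  (* Truncated subtraction makes [size J - k] equal to 0: nothing has been dropped yet. *)
  have c0 : c = [::] by apply: size0nil; clear -sc Jk; lia.
  exists (weight q + total_weight J), [::]; split=> //=; first by rewrite psum0 addr0.
  rewrite tot c0 /= psum0. by nra.
case: ifPn => [acc|]; last rewrite -ltNge => rej.
  by exists (weight q + total_weight J), [::]; split=> //=; rewrite psum0 addr0.
exists W, (rcons c (weight q)); split=> //.
- by rewrite all_rcons q0 size_rcons; split=> //; clear -sc Jk; lia.
- by rewrite tot size_rcons psumS psum_rcons// nth_rcons ltnn eqxx; ring.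
- by rewrite last_rcons.
(* For the entry dropped just now, the claim is the failed acceptance test. *)
move=> i; rewrite size_rcons ltnS leq_eqVlt => /orP[/eqP ic|ic].
  rewrite nth_rcons -ic ltnSn psumS psum_rcons -?ic// nth_rcons -ic ltnn eqxx.
  have -> : c`_i = v by rewrite vE -nth_last -ic.
  by move: rej; rewrite tot -ic; congr (_ < _); ring.
rewrite nth_rcons (ltnW ic) psum_rcons//; exact: drop.
Qed.

(** From [a * W <= V] and the bounds on dropped weights, each of these is below [a] times the
    partial sum of the chain that includes its successor. The chain has length at most [n - k], so
    by [alpha_attained] its last weight, which is pending, makes up for the whole chain. *)
Lemma run_ratio (k n : nat) J : (k < n)%N -> (size J <= n)%N ->
  all (@valid_request R) J -> alpha R (n - k) * total_weight J <=
    secured (run k (alpha R (n - k)) J) + pending (run k (alpha R (n - k)) J).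
Proof.
move=> kn Jn vJ; set a := alpha R (n - k); have nk : (n - k = (n - k).-1.+1)%N by clear -kn; lia.
have a1 : a <= 1 by rewrite /a nk alpha_le1.
have a0 : 0 <= a by exact: alpha_ge0.
have := @run_chain k a J vJ a1; case: (run k a J) => x V v /= [W [c]].
move=> [[pc sc] -> Wa -> drop].
case: (lastP c) pc sc drop => [_ _ _|{}c w pc]; first by rewrite psum0 !addr0.
rewrite size_rcons last_rcons => sc drop; rewrite mulrDr; apply: lerD => //.
suff: a * psum (rcons c w) (size c).+1 <= (rcons c w)`_(size c).
  by rewrite nth_rcons ltnn eqxx.
rewrite /a nk; apply: alpha_attained => //; rewrite ?size_rcons//; first by clear -sc Jn kn; lia.
move=> i ic; rewrite -nk -/a; have := drop i ic; nra.
Qed.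

Lemma performance_lower_bound (k n : nat) (T : R) : (k < n)%N -> 1 <= T <= 2 ->
  k%:R * (2 - T) <= 1 -> exists2 ALG, online ALG &
  forall I, instances n T I -> alpha R (n - k) <= performance (ALG I) I.
Proof.
move=> kn Tb kT; exists (algorithm k (alpha R (n - k))); first exact: algorithm_online.
move=> I iI; have [/andP[vI _] /andP[I0 In] _] := iI.
have /andP[T1 _] := Tb; have sp := instances_spaced T1 iI.
rewrite performanceE ler_pdivlMr; last exact: total_weight_gt0.
have := run_gain (alpha R (n - k)) Tb kT sp; rewrite gain_rev; apply: le_trans.
by rewrite -total_weight_rev; apply: run_ratio; rewrite ?size_rev ?all_rev.
Qed.

End Lower.

(** * Competitive ratios *)

Section Ratio.
Variable R : realType.
Implicit Types (x y : R -> R) (q : request R) (I : seq (request R)).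

Lemma performance_ge0 x I : all (@valid_request R) I -> 0 <= performance x I.
Proof.
move=> vI; rewrite performanceE divr_ge0 ?gain_ge0//.
exact: le_trans (gain_ge0 (fun=> True) vI) (gain_le_total_weight _ vI).
Qed.

Lemma performance_le1 x I : all (@valid_request R) I -> performance x I <= 1.
Proof.
move=> vI; rewrite performanceE; have := gain_le_total_weight (served x) vI.
have [->|I0] := eqVneq (total_weight I) 0; first by rewrite invr0 mulr0 ler01.
have t0 : 0 < total_weight I.
  rewrite lt_neqAle eq_sym I0.
  exact: le_trans (gain_ge0 (fun=> True) vI) (gain_le_total_weight _ vI).
by rewrite ler_pdivrMr// mul1r.
Qed.

Lemma performance_OPT_ub I : all (@valid_request R) I ->
  has_ubound [set performance x I | x in @trajectory R]%classic.
Proof. by move=> vI; exists 1 => _ [x _ <-]; exact: performance_le1. Qed.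

Lemma performance_OPT_ge x I : all (@valid_request R) I -> trajectory x ->
  performance x I <= performance_OPT I.
Proof. by move=> vI xT; apply: (ub_le_sup (performance_OPT_ub vI)); exists x. Qed.

Lemma performance_OPT_le1 I : all (@valid_request R) I -> performance_OPT I <= 1.
Proof.
move=> vI; apply: ge_sup => [|_ [x _ <-]]; last exact: performance_le1.
by exists (performance (fun=> 0) I), (fun=> 0) => //; exact: static_trajectory.
Qed.

Lemma performance_le_ratio x I : all (@valid_request R) I -> trajectory x ->
  performance x I <= performance x I / performance_OPT I.
Proof.
move=> vI xT; have p0 := performance_ge0 x vI.
have := performance_OPT_ge vI xT; have := performance_OPT_le1 vI.
have [-> _ _|pn0 o1 po] := eqVneq (performance x I) 0; first by rewrite mul0r.
have o0 : 0 < performance_OPT I by rewrite (lt_le_trans _ po)// lt_neqAle eq_sym pn0.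
by rewrite ler_pdivlMr// -[leRHS]mulr1 ler_wpM2l.
Qed.

(** [y] is any offline route: its performance bounds the optimum from below, and the total weights
    cancel. *)
Lemma ratio_le x y I (b : R) : all (@valid_request R) I -> (0 < size I)%N ->
  trajectory y -> 0 <= b -> 0 < gain (served y) I ->
  gain (served x) I <= b * gain (served y) I ->
  performance x I / performance_OPT I <= b.
Proof.
move=> vI I0 yT b0 y0 xy; have t0 := total_weight_gt0 vI I0.
have yO := performance_OPT_ge vI yT.
have py0 : 0 < performance y I by rewrite performanceE divr_gt0.
rewrite ler_pdivrMr ?(lt_le_trans py0)//.
apply: (@le_trans _ _ (b * performance y I)); last exact: ler_wpM2l.
by rewrite !performanceE mulrA ler_pM2r ?invr_gt0.
Qed.

Lemma ratio_le1 x I : all (@valid_request R) I -> trajectory x ->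
  performance x I / performance_OPT I <= 1.
Proof.
move=> vI xT; have xO := performance_OPT_ge vI xT.
have [->|/negPf On0] := eqVneq (performance_OPT I) 0; first by rewrite invr0 mulr0 ler01.
rewrite ler_pdivrMr ?mul1r// lt_neqAle eq_sym On0.
exact: le_trans (performance_ge0 x vI) xO.
Qed.

(** Both values are squeezed in [a <= lambda <= gamma <= a]: as the optimum is at most 1, passing
    from performance to ratio can only increase the value. *)
Lemma value_eq (n : nat) (T a : R) :
  (exists2 ALG, online ALG & forall I, instances n T I -> a <= performance (ALG I) I) ->
  (forall ALG e, online ALG -> 0 < e -> exists2 I, instances n T I &
     performance (ALG I) I / performance_OPT I <= a + e) ->
  lambda n T = a /\ gamma n T = a.
Proof.
move=> [ALG0 on0 low] up.
have valid I : instances n T I -> all (@valid_request R) I by case=> /andP[].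
have traj ALG I : online ALG -> instances n T I -> trajectory (ALG I).
  by move=> [onT _] [iI _ _]; exact: onT.
(* Some instance exists, so that the infima are not over empty sets. *)
have [I0 iI0 _] := up ALG0 1 on0 ltr01.
have lbl ALG : has_lbound [set performance (ALG I) I | I in instances n T]%classic.
  by exists 0 => _ [I /valid vI <-]; exact: performance_ge0.
have lbg ALG : online ALG -> has_lbound
    [set performance (ALG I) I / performance_OPT I | I in instances n T]%classic.
  move=> on; exists 0 => _ [I iI <-]; have vI := valid _ iI.
  exact: le_trans (performance_ge0 _ vI) (performance_le_ratio vI (traj _ _ on iI)).
have gle ALG : online ALG -> gamma_ALG ALG n T <= a.
  move=> on; apply/ler_addgt0Pr => e e0; have [I iI] := up ALG e on e0.
  by apply: le_trans; apply: (ge_inf (lbg _ on)); exists I.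
have lle ALG : online ALG -> lambda_ALG ALG n T <= gamma_ALG ALG n T.
  move=> on; apply: lb_le_inf; first by exists (performance (ALG I0) I0 / performance_OPT I0), I0.
  move=> _ [I iI <-]; have vI := valid _ iI.
  apply: le_trans (performance_le_ratio vI (traj _ _ on iI)).
  by apply: (ge_inf (lbl ALG)); exists I.
have al : a <= lambda_ALG ALG0 n T.
  apply: lb_le_inf; first by exists (performance (ALG0 I0) I0), I0.
  by move=> _ [I iI <-]; exact: low.
split; apply/eqP; rewrite eq_le; apply/andP; split.
- apply: ge_sup; first by exists (lambda_ALG ALG0 n T), ALG0.
  by move=> _ [ALG on <-]; exact: le_trans (lle _ on) (gle _ on).
- apply: (le_trans al); apply: ub_le_sup; last by exists ALG0.
  by exists a => _ [ALG on <-]; exact: le_trans (lle _ on) (gle _ on).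
- apply: ge_sup; first by exists (gamma_ALG ALG0 n T), ALG0.
  by move=> _ [ALG on <-]; exact: gle.
apply: (le_trans (le_trans al (lle _ on0))); apply: ub_le_sup; last by exists ALG0.
by exists a => _ [ALG on <-]; exact: gle.
Qed.

End Ratio.

(** * The adversary *)

Section Adversary.
Variable R : realType.
Implicit Types (x y : R -> R) (q : request R) (I : seq (request R)).

(** Routes are continuous. The inequality is used in both directions. *)
Lemma trajectory_le_left_limit x y (r : R) : trajectory x -> trajectory y -> 0 <= r ->
  (forall t : R, 0 <= t -> t < r -> x t = y t) -> x r <= y r.
Proof.
move=> xT yT r0 xy; rewrite leNgt; apply/negP => yx.
have [r1|r1] := ltP 0 r; last first.
  have rE : r = 0 by lra.
  by move: yx; rewrite rE; case: xT => -> _ _; case: yT => -> _ _; rewrite ltxx.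
(* From [t] to [r] the routes separate by at most [2 * (r - t)], half of the assumed gap. *)
pose t := Num.max 0 (r - (x r - y r) / 4).
have t0 : 0 <= t by rewrite le_max lexx.
have tr : t < r by rewrite gt_max r1 /=; lra.
have rt : r - (x r - y r) / 4 <= t by rewrite le_max lexx orbT.
have := xy _ t0 tr; have := trajectory_lip xT t0 (ltW tr).
have := trajectory_lip yT t0 (ltW tr); lra.
Qed.

(** At time [release q] the algorithm already knows [q], so being online gives agreement before that
    time only; continuity adds the time itself. *)
Lemma online_agree ALG I q : online ALG -> instance I -> instance (rcons I q) ->
  0 <= release q -> forall t, 0 <= t <= release q -> ALG (rcons I q) t = ALG I t.
Proof.
move=> [onT on] iI iJ r0.
have before t : 0 <= t -> t < release q -> ALG (rcons I q) t = ALG I t.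
  move=> t0 tr; apply: (on _ _ t) => //; last by rewrite t0 lexx.
  by rewrite /released -cats1 filter_cat /= leNgt tr cats0.
move=> t /andP[t0]; rewrite le_eqVlt => /orP[/eqP ->|]; last exact: before.
have xT := onT _ iJ; have yT := onT _ iI.
by apply/eqP; rewrite eq_le !trajectory_le_left_limit// => s s0 sr; rewrite before.
Qed.

(** [r] is an admissible release time for one more request. *)
Definition extensible (T : R) I (r : R) : Prop :=
  [/\ instance I, sorted (fun p q => T <= release q - release p) I,
      all (fun p => release p + T <= r) I & 0 <= r].

Lemma sorted_rcons_all (A : Type) (e : rel A) (s : seq A) (a : A) :
  sorted e s -> all (e^~ a) s -> sorted e (rcons s a).
Proof.
case: s => //= b s; elim: s b => [|c s IH] b /=; first by move=> _ /andP[->].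
by move=> /andP[-> cs] /and3P[_ ca sa]; rewrite IH//= ca.
Qed.

Lemma extensible_rcons (T : R) I r q : 0 <= T -> extensible T I r ->
  valid_request q -> release q = r ->
  instance (rcons I q) /\ sorted (fun p q => T <= release q - release p) (rcons I q).
Proof.
move=> T0 [/andP[vI sI] gI rI r0] vq qr; split.
  rewrite /instance all_rcons vq vI /=; apply: sorted_rcons_all => //.
  by apply: sub_all rI => p pr; lra.
by apply: sorted_rcons_all => //; apply: sub_all rI => p pr; lra.
Qed.

Lemma extensible_next (T : R) I r q r' : 0 <= T -> extensible T I r ->
  valid_request q -> release q = r -> r + T <= r' -> extensible T (rcons I q) r'.
Proof.
move=> T0 ex vq qr rr; have [? ?] := extensible_rcons T0 ex vq qr.
have [_ _ rI r0] := ex; split=> //; last lra.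
by rewrite all_rcons qr rr /=; apply: sub_all rI => p pr; lra.
Qed.

(** Take a visit [t] within [e] of the infimum of all visits in the window: [t - e] precedes each of
    them, and the vehicle is then at most [e] away. No visit comes before [release q + D]. *)
Lemma almost_first_visit x q (e D : R) : trajectory x -> 0 <= release q -> served x q ->
  0 < e <= D -> D <= `|location q - x (release q)| ->
  exists r, [/\ release q + D - e <= r, `|x r - location q| <= e & ~ served_by x r q].
Proof.
move=> xT q0 [t0 [t0q xt0]] /andP[e0 eD] dist.
pose E := [set t : R | release q <= t <= release q + 2 /\ x t = location q]%classic.
have lbE : has_lbound E by exists (release q) => t [/andP[]].
have [t [/andP[qt tq] xt] tinf] : exists2 t, E t & t < inf E + e.
  by apply: inf_adherent => //; split=> //; exists t0.
have Dt : release q + D <= t.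
  have := trajectory_lip xT q0 qt; rewrite xt => lip.
  suff : `|location q - x (release q)| <= t - release q by lra.
  by rewrite ler_norml; lra.
exists (t - e); split; first lra.
  have te0 : 0 <= t - e by lra.
  by have := trajectory_lip xT te0 (_ : t - e <= t); rewrite xt ler_norml; lra.
move=> [u [uq ue xu]]; have : inf E <= u by apply: (ge_inf lbE); split.
by lra.
Qed.

(** A geometric sequence of ratio [(1 + e) / e] ending in [d0]: if the weights before [v i] sum to
    at most [e * v i], then together with it they sum to at most [(1 + e) * v i = e * v i.+1]. *)
Lemma small_weights (k : nat) (e d0 : R) : 0 < e -> 0 < d0 ->
  exists v : nat -> R, v k = d0 /\ forall i, (i <= k)%N ->
    0 < v i /\ \sum_(j < i) v j <= e * v i.
Proof.
move=> e0 d00; pose rho := e / (1 + e).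
have rho0 : 0 < rho by apply: divr_gt0; lra.
exists (fun i => d0 * rho ^+ (k - i)); split; first by rewrite subnn expr0 mulr1.
have pos i : 0 < d0 * rho ^+ (k - i) by rewrite mulr_gt0// exprn_gt0.
elim=> [_|i IH ik]; first by rewrite big_ord0 mulr_ge0// ltW.
split=> //; rewrite big_ord_recr /=; have [_ h] := IH (ltnW ik).
have vE : d0 * rho ^+ (k - i) = rho * (d0 * rho ^+ (k - i.+1)).
  by rewrite mulrCA -exprS subnSK.
have rE : rho * (1 + e) = e by rewrite /rho mulfVK//; lra.
move: h; rewrite {}vE; move: (d0 * rho ^+ (k - i.+1)) => u h.
suff -> : e * u = e * (rho * u) + rho * u by lra.
by rewrite -[in LHS]rE; ring.
Qed.

End Adversary.

(** * The light requests *)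

Section Game.
Variables (R : realType) (ALG : seq (request R) -> R -> R) (n : nat) (T b : R).
Implicit Types (x y : R -> R) (q : request R) (I A B : seq (request R)).

Definition beaten : Prop := exists2 I, instances n T I &
  performance (ALG I) I / performance_OPT I <= b.

Lemma endpoint_reach (t : R) (s : R) : s = 1 \/ s = -1 -> 1 <= t ->
  headTo (fun=> 0) 0 s t = s.
Proof.
by move=> sE t1; apply: headTo_reach; rewrite add0r subr0; case: sE => ->;
  rewrite ?normrN normr1.
Qed.

Lemma endpoint_in (s : R) : s = 1 \/ s = -1 -> -1 <= s <= 1.
Proof. by case=> ->; rewrite lexx; lra. Qed.

(** An offline vehicle that goes to the endpoint at once and waits there gains at least [weight q],
    the algorithm at most [e * weight q]. *)
Lemma beaten_if_unserved I q (e : R) : online ALG -> 0 <= T -> (size I < n)%N ->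
  extensible T I (release q) -> valid_request q -> location q = 1 \/ location q = -1 ->
  0 <= e <= b -> total_weight I <= e * weight q ->
  ~ served (ALG (rcons I q)) q -> beaten.
Proof.
move=> on T0 In ex vq lq /andP[e0 eb] small uns.
have [iI sI] := extensible_rcons T0 ex vq erefl.
have [vI' _] := andP iI; have [/andP[vI _] _ _ q0] := ex.
exists (rcons I q); first by split=> //; rewrite size_rcons.
have w0 := valid_weight vq.
pose y := headTo (fun=> 0 : R) 0 (location q).
have yT : trajectory y.
  by apply: headTo_trajectory => //; [exact: static_trajectory | exact: endpoint_in].
have yq : served y q.
  by exists (release q + 1); split; [lra | apply: endpoint_reach => //; lra].
have gy : weight q <= gain (served y) (rcons I q).
  by rewrite gain_rcons gain1_in// lerDr gain_ge0.
apply: (@ratio_le _ _ y) => //; rewrite ?size_rcons//; [lra|lra|].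
rewrite gain_rcons gain1_out// addr0.
have := gain_le_total_weight (served (ALG (rcons I q))) vI.
have : e * weight q <= b * gain (served y) (rcons I q) by nra.
lra.
Qed.

(** [s] is the endpoint of the next request, opposite to the side to which the vehicle has been
    pushed. A request left unserved beats the algorithm; otherwise reaching it takes at least
    [1 + i * (2 - T)]. *)
Lemma push_aside (k : nat) (v : nat -> R) (e : R) : online ALG -> 1 <= T <= 2 ->
  (k < n)%N -> k%:R * (2 - T) <= 1 -> 0 <= e <= b ->
  (forall i, (i <= k)%N -> 0 < v i /\ \sum_(j < i) v j <= e * v i) ->
  forall i, (i <= k)%N -> beaten \/ exists I (r s : R),
    [/\ extensible T I r, size I = i, total_weight I = \sum_(j < i) v j,
        s = 1 \/ s = -1 & s * ALG I r <= - (i%:R * (2 - T))].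
Proof.
move=> on /andP[T1 T2] kn kT eb vP; elim=> [_|i IH ik].
  right; exists [::], 0, 1.
  have -> : ALG [::] 0 = 0 by have [onT _] := on; case: (onT [::] erefl).
  split; rewrite ?mulr0 ?mul0r ?oppr0//; last by left.
  by rewrite big_ord0 /total_weight big_nil.
have [|[I [r [s [ex sI tI sE far]]]]] := IH (ltnW ik); first by left.
have T0 : 0 <= T by lra.
have [v0 small] := vP i (ltnW ik).
have [iI _ _ r0] := ex.
pose q := Request s r (v i).
have vq : valid_request q by rewrite /valid_request /= endpoint_in// r0 v0.
have [iJ sJ] := extensible_rcons T0 ex vq erefl.
have [/= [t [tr xt]]|uns] := pselect (served (ALG (rcons I q)) q); last first.
  by left; apply: (beaten_if_unserved (e := e)) uns; rewrite ?tI ?sI ?(ltn_trans ik)//.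
have xT : trajectory (ALG (rcons I q)) by have [onT _] := on; exact: onT.
have xr : ALG (rcons I q) r = ALG I r.
  by apply: online_agree => //=; rewrite r0 lexx.
rewrite /= in tr xt.
have lip1 := trajectory_lip xT r0 (_ : r <= t).
(* If the request is served before [r + T], at most [T - 1 - i * (2 - T)] remains to leave the
   endpoint, so the vehicle is still at least [(i + 1) * (2 - T)] from the center. Otherwise it is
   at the endpoint itself. *)
set r' := Num.max (r + T) t.
have r't : t <= r' by rewrite le_max lexx orbT.
have r'r : r + T <= r' by rewrite le_max lexx.
have r'E : r' = r + T \/ r' = t by rewrite /r'; case: leP; [right|left].
have t0 : 0 <= t by lra.
have lip2 := trajectory_lip xT t0 r't.
have iT : (i.+1)%:R * (2 - T) <= 1.
  apply: le_trans kT; apply: ler_wpM2r; first lra.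
  by rewrite ler_nat.
right; exists (rcons I q), r', (- s); split.
- exact: extensible_next r'r.
- by rewrite size_rcons sI.
- by rewrite total_weight_rcons tI big_ord_recr.
- by case: sE => ->; rewrite ?opprK; [right|left].
move: lip1; rewrite xr xt; rewrite {}xt in lip2.
rewrite -natr1 in iT *; rewrite mulrDl mul1r in iT *.
move: far iT; move: (_%:R * (2 - T)) => u far iT lip1.
have {}lip1 : ALG I r - (t - r) <= s <= ALG I r + (t - r) by apply: lip1; lra.
by clear -tr r'E lip2 far iT lip1 sE T2; case: sE => sE; subst s; case: r'E => r'E; lra.
Qed.

End Game.

(** * The heavy requests *)

Section Duel.
Variables (R : realType) (ALG : seq (request R) -> R -> R) (n : nat) (T b : R).
Implicit Types (x y : R -> R) (q : request R) (I A B : seq (request R)).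

(* By time [r], ALG has lost every request of [B] and is about to reach the
   pending request [q], whereas [y] has served all of them by time [c]. *)
Definition duel (k : nat) (d : seq R) (e h : R) (j : nat) : Prop :=
  exists A B q (r : R) y (c : R), let x := ALG (A ++ rcons B q) in
  [/\ [/\ extensible T (A ++ rcons B q) r, size A = k, size B = j &
         total_weight A <= e * d`_0],
      [/\ valid_request q, weight q = d`_j, location q = 1 \/ location q = -1 &
         total_weight B = psum d j],
      [/\ forall x', (forall t : R, 0 <= t <= r -> x' t = x t) -> gain (served x') B = 0,
         ~ served_by x r q, `|x r - location q| <= h & release q + T <= r] &
      [/\ trajectory y, release q <= c, y c = location q, c + 2 <= r + 1 + j%:R * (2 * h) &
         psum d j.+1 <= gain (served_by y c) (rcons B q)]].

Variables (k m : nat) (d : seq R) (e h : R).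

(** The vehicle is at least [1 + k * (2 - T)] away from the endpoint. By the second bound on [h], a
    time [T] has elapsed even at [h] before that travel time is over. *)
Lemma duel_start I (r s : R) : online ALG -> 1 <= T <= 2 -> (0 < k < n)%N ->
  0 < h -> h <= k.+1%:R * (2 - T) - 1 -> h <= 1 ->
  all (fun a => 0 < a) d -> (0 < size d)%N -> 0 <= e <= b ->
  extensible T I r -> size I = k -> total_weight I <= e * d`_0 ->
  s = 1 \/ s = -1 -> s * ALG I r <= - (k%:R * (2 - T)) ->
  beaten ALG n T b \/ duel k d e h 0.
Proof.
move=> on /andP[T1 T2] /andP[k0 kn] h0 hk h1 pd sd eb ex sI small sE far.
have T0 : 0 <= T by lra.
have d0 := nth_gt0 pd sd; have [iI _ rI r0] := ex.
pose q := Request s r d`_0.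
have vq : valid_request q by rewrite /valid_request /= endpoint_in// r0 d0.
have [iJ sJ] := extensible_rcons T0 ex vq erefl.
have [serv|uns] := pselect (served (ALG (rcons I q)) q); last first.
  by left; apply: (beaten_if_unserved (e := e)) uns => //; rewrite sI.
right; have xT : trajectory (ALG (rcons I q)) by have [onT _] := on; exact: onT.
have xr : ALG (rcons I q) r = ALG I r.
  by apply: online_agree => //=; rewrite r0 lexx.
have kT0 : 0 <= k%:R * (2 - T) by apply: mulr_ge0; [exact: ler0n|lra].
have dist : 1 + k%:R * (2 - T) <= `|s - ALG (rcons I q) r|.
  rewrite xr; move: far; move: (_%:R * _) => u.
  by case: sE => -> far; rewrite ler_normr; apply/orP; [left|right]; lra.
have [|r' [r'q near unv]] := almost_first_visit (q := q) (D := 1 + k%:R * (2 - T))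
  (e := h) xT r0 serv _ dist.
  by rewrite h0 /=; lra.
rewrite -natr1 mulrDl mul1r in hk; rewrite /= in r'q.
have rr' : r + T <= r' by lra.
(* As [k > 0], there is an earlier request, whence [r >= T >= 1]: an offline vehicle can be at the
   endpoint by time [r]. *)
have r1 : 1 <= r.
  case: (I) sI rI iI => [|p I' _ /andP[pr _] /andP[/andP[/valid_release p0 _] _]]; last lra.
  by move=> kE; rewrite -kE in k0.
exists I, [::], q, r', (headTo (fun=> 0) 0 s), r; rewrite cats1 /=; split.
- by split=> //; exact: extensible_next rr'.
- by split=> //; rewrite psum0 /total_weight big_nil.
- by split=> // x' _; rewrite /gain big_nil.
split=> //.
- by apply: headTo_trajectory => //; [exact: static_trajectory|exact: endpoint_in].
- exact: endpoint_reach.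
- by rewrite mul0r addr0; lra.
rewrite psumS psum0 add0r gain1_in//.
by exists r; split; rewrite /= ?lexx//; [lra | exact: endpoint_reach].
Qed.

(** A request [q'] is released at the opposite endpoint at time [r]. If the algorithm leaves it
    unserved, it gains little more than the weight of [q], against [psum d j.+2] offline. If it
    serves [q'], it loses [q] and the duel goes on. *)
Lemma duel_step j : online ALG -> 1 <= T <= 2 -> (k + m < n)%N -> (j < m)%N ->
  size d = m.+1 -> all (fun a => 0 < a) d -> 0 <= b ->
  0 < h -> 2 * h <= 2 - T -> m%:R * (2 * h) <= 1 ->
  e * d`_0 + d`_j <= b * psum d j.+2 ->
  duel k d e h j -> beaten ALG n T b \/ duel k d e h j.+1.
Proof.
move=> on /andP[T1 T2] kmn jm sd pd b0 h0 hT hm good.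
case=> A [B [q [r [y [c [[ex sA sB small] [vq wq lq tB] [lost unv near gap] [yT qc yc cr gy]]]]]]].
have T0 : 0 <= T by lra.
have hj : j%:R * (2 * h) <= 1.
  by apply: le_trans hm; apply: ler_wpM2r; [lra | rewrite ler_nat ltnW].
have d0 i : (i <= m)%N -> 0 < d`_i by move=> im; apply: nth_gt0; rewrite // sd.
have [iI _ _ r0] := ex; have q0 := valid_release vq.
set I := A ++ rcons B q in ex unv near lost iI *.
have xT0 : trajectory (ALG I) by have [onT _] := on; exact: onT.
pose q' := Request (- location q) r d`_j.+1.
have lq' : location q' = 1 \/ location q' = -1.
  by rewrite /=; case: lq => ->; rewrite ?opprK; [right|left].
have vq' : valid_request q' by rewrite /valid_request /= endpoint_in// r0 d0.
have [iJ sJ] := extensible_rcons T0 ex vq' erefl.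
have [vJ _] := andP iJ; have [vI _] := andP iI.
have [vA vB] : all (@valid_request R) A /\ all (@valid_request R) B.
  by move: vI; rewrite all_cat all_rcons => /and3P[].
have xT : trajectory (ALG (rcons I q')) by have [onT _] := on; exact: onT.
have agree t : 0 <= t <= r -> ALG (rcons I q') t = ALG I t.
  by move=> tr; apply: online_agree.
have inst : instances n T (rcons I q').
  split=> //; rewrite size_rcons /I size_cat size_rcons sA sB.
  by clear -kmn jm; lia.
have unv' : ~ served_by (ALG (rcons I q')) r q.
  by apply: contra_not unv; apply: served_by_mono => // t t0 tr; rewrite agree// t0.
(* Crossing takes 2, and [q] is unserved at [r]: [q'] after [q] would be served later than [r + 2],
   and [q] after [q'] not before [r + 2], when its window is closed. *)
have conflict : served (ALG (rcons I q')) q -> ~ served (ALG (rcons I q')) q'.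
  move=> [t [tq xt]] [u [/= ur xu]]; have [tr|tr] := leP t r.
    by apply: unv'; exists t.
  have [tu|/ltW ut] := leP t u.
    have := trajectory_lip xT (_ : 0 <= t) tu; rewrite xt xu => /(_ ltac:(lra)).
    by case: lq => ->; lra.
  have := trajectory_lip xT (_ : 0 <= u) ut; rewrite xt xu => /(_ ltac:(lra)).
  by case: lq => ->; lra.
(* The offline vehicle crosses once it has served [q] and, if early, waits for the release of [q'].
   The bound on [m%:R * (2 * h)] keeps its arrival within the window of [q']. *)
pose y' := headTo y c (- location q); pose c' := Num.max (c + 2) r.
have c'c : c + 2 <= c' by rewrite le_max lexx.
have c'r : r <= c' by rewrite le_max lexx orbT.
have c'E : c' = c + 2 \/ c' = r by rewrite /c'; case: leP; [right|left].
have c0 : 0 <= c by lra.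
have y'T : trajectory y' by apply: headTo_trajectory => //; exact: (endpoint_in lq').
have y'c : y' c' = - location q.
  apply: headTo_reach; rewrite yc; apply: le_trans c'c; rewrite lerD2l.
  by case: lq => ->; rewrite ler_norml; lra.
have y'q' : served_by y' c' q'.
  by exists c'; split=> //=; case: c'E => c'E; lra.
have vBq : all (@valid_request R) (rcons B q) by rewrite all_rcons vq.
have gy' : psum d j.+2 <= gain (served_by y' c') (rcons (rcons B q) q').
  rewrite gain_rcons gain1_in// psumS lerD2r; apply: (le_trans gy).
  apply: gain_served_by_mono => //; first lra.
  by move=> t _ tc; rewrite /y' headTo_before.
have ps : 0 < psum d j.+2 by apply: psum_gt0; rewrite // sd.
have gy'J : psum d j.+2 <= gain (served y') (rcons I q').
  have -> : rcons I q' = A ++ rcons (rcons B q) q' by rewrite /I rcons_cat.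
  rewrite gain_cat; apply: (le_trans gy').
  have vC : all (@valid_request R) (rcons (rcons B q) q') by rewrite all_rcons vq' vBq.
  have : gain (served_by y' c') (rcons (rcons B q) q') <=
      gain (served y') (rcons (rcons B q) q').
    by apply: gain_mono => // p _; exact: served_by_served.
  have := gain_ge0 (served y') vA; lra.
have gx : gain (served (ALG (rcons I q'))) (rcons I q') <= e * d`_0 +
    gain (served (ALG (rcons I q'))) [:: q] + gain (served (ALG (rcons I q'))) [:: q'].
  rewrite gain_rcons /I gain_cat gain_rcons lost// add0r !lerD2r.
  exact: le_trans (gain_le_total_weight _ vA) small.
have dj0 := d0 _ (ltnW jm).
have lose : gain (served (ALG (rcons I q'))) [:: q'] = 0 -> beaten ALG n T b.
  move=> g0; exists (rcons I q') => //; apply: (@ratio_le _ _ y') => //.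
  - by rewrite size_rcons.
  - exact: lt_le_trans ps gy'J.
  apply: (le_trans gx); rewrite g0 addr0.
  apply: (@le_trans _ _ (b * psum d j.+2)); last exact: ler_wpM2l.
  apply: le_trans good; rewrite lerD2l -wq.
  have v1 : all (@valid_request R) [:: q] by rewrite /= vq.
  apply: le_trans (gain_le_total_weight _ v1) _.
  by rewrite total_weight_cons /total_weight big_nil addr0.
have [serv|uns] := pselect (served (ALG (rcons I q')) q').
  have nq : ~ served (ALG (rcons I q')) q by move=> /conflict.
  (* Being within [h] of one endpoint leaves [2 - h] to the other, and stopping early costs another
     [h]: hence the [2 * h] per round. *)
  have dist : 2 - h <= `|location q' - ALG (rcons I q') r|.
    rewrite agree ?r0 ?lexx//=; move: near; rewrite ler_norml ler_normr => near.
    by apply/orP; move: near; case: lq => ->; [right|left]; lra.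
  have [|r' [/= r'q near' unv'']] := almost_first_visit (q := q') (e := h) xT r0 serv _ dist.
    by rewrite h0; lra.
  have rr' : r + T <= r' by lra.
  right; exists A, (rcons B q), q', r', y', c'; rewrite -rcons_cat -/I; split.
  - by split=> //; [exact: extensible_next rr' | rewrite size_rcons sB].
  - by split=> //; rewrite total_weight_rcons tB wq psumS.
  (* The window of [q] closes at [release q + 2 <= r + 2 - T <= r'], so every route that agrees up
     to [r'] misses [q] as well. *)
  - split=> // x' x'E; rewrite gain_rcons lost ?add0r; last first.
      by move=> t /andP[t0 tr]; rewrite x'E ?agree ?t0//; lra.
    apply: gain1_out => -[t [tq xt]]; apply: nq; exists t; split=> //.
    by rewrite -x'E//; lra.
  have hj0 : 0 <= j%:R * (2 * h) by apply: mulr_ge0; [exact: ler0n|lra].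
  split=> //; rewrite -natr1 mulrDl mul1r.
  by case: c'E => c'E; lra.
by left; apply: lose; rewrite gain1_out.
Qed.

(** With no further request, [q] is the only heavy request that the algorithm can still serve: this
    is the last quotient in [alpha_max]. *)
Lemma duel_end : online ALG -> 1 <= T -> (k + m < n)%N -> size d = m.+1 ->
  all (fun a => 0 < a) d -> 0 <= b -> e * d`_0 + d`_m <= b * psum d m.+1 ->
  duel k d e h m -> beaten ALG n T b.
Proof.
move=> on T1 kmn sd pd b0 good.
case=> A [B [q [r [y [c [[ex sA sB small] [vq wq lq tB] [lost unv near gap] [yT qc yc cr gy]]]]]]].
have [iI sI _ r0] := ex; have [vI _] := andP iI.
have [vA vBq] : all (@valid_request R) A /\ all (@valid_request R) (rcons B q).
  by move: vI; rewrite all_cat => /andP[].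
exists (A ++ rcons B q); first by split=> //; rewrite size_cat size_rcons sA sB; clear -kmn; lia.
have gy' : psum d m.+1 <= gain (served y) (A ++ rcons B q).
  rewrite gain_cat; apply: (le_trans gy).
  have : gain (served_by y c) (rcons B q) <= gain (served y) (rcons B q).
    by apply: gain_mono => // p _; exact: served_by_served.
  have := gain_ge0 (served y) vA; lra.
have ps : 0 < psum d m.+1 by apply: psum_gt0; rewrite // sd.
apply: (@ratio_le _ _ y) => //.
- by rewrite size_cat size_rcons addnS.
- exact: lt_le_trans ps gy'.
apply: (@le_trans _ _ (b * psum d m.+1)); last exact: ler_wpM2l.
apply: le_trans good; rewrite gain_cat gain_rcons lost// add0r; apply: lerD.
  exact: le_trans (gain_le_total_weight _ vA) small.
have v1 : all (@valid_request R) [:: q] by rewrite /= vq.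
apply: le_trans (gain_le_total_weight _ v1) _.
by rewrite total_weight_cons /total_weight big_nil addr0 wq.
Qed.

End Duel.

(** * The upper bound on the ratio *)

Section Value.
Variable R : realType.

Lemma psum_ge_head (d : seq R) i : all (fun a => 0 < a) d -> d`_0 <= psum d i.+1.
Proof.
case: d => [|a d] pd; first exact: psum_ge0.
by rewrite psum_cons lerDl psum_ge0//; case/andP: pd.
Qed.

Lemma competitive_upper_bound ALG (k n : nat) (T e : R) : online ALG -> 1 <= T <= 2 ->
  (0 < k < n)%N -> k%:R * (2 - T) <= 1 -> 1 < k.+1%:R * (2 - T) -> 0 < e ->
  beaten ALG n T (alpha R (n - k) + e).
Proof.
move=> on /[dup] Tb /andP[T1 T2] /andP[k0 kn] kT kT' e0.
have [m nk] : exists m, (n - k = m.+1)%N by exists (n - k).-1; clear -kn; lia.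
have kmn : (k + m < n)%N by clear -kn nk; lia.
have e20 : 0 < e / 2 by lra.
(* Half of [e] allows for a [d] that only nearly attains the infimum, the other half absorbs the
   light requests. *)
have [_ [d /= pd <-] de] := inf_adherent e20
  (conj (alpha_nonempty R (n - k)) (@alpha_lbound R (n - k))).
move: de; rewrite -/(alpha R (n - k)); set b := _ + e => de.
have sd : size d = m.+1 by rewrite size_tuple.
have bd : alpha_max d + e / 2 <= b by rewrite /b; lra.
have ad0 := alpha_max_ge0 pd.
have d0 : 0 < d`_0 by apply: nth_gt0; rewrite // sd.
have good (i : nat) u : u / psum d i.+1 <= alpha_max d -> e / 2 * d`_0 + u <= b * psum d i.+1.
  have p0 : 0 < psum d i.+1 by apply: psum_gt0; rewrite // sd.
  rewrite ler_pdivrMr// => ua; have := psum_ge_head i pd => dp.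
  apply: (@le_trans _ _ ((alpha_max d + e / 2) * psum d i.+1)); last by rewrite ler_pM2r.
  nra.
have goodj j : (j < m)%N -> e / 2 * d`_0 + d`_j <= b * psum d j.+2.
  by move=> jm; apply: good; apply: alpha_max_ge; rewrite nk.
have goodm : e / 2 * d`_0 + d`_m <= b * psum d m.+1.
  apply: good; suff <- : d`_(n - k).-1 / psum d (n - k) = d`_m / psum d m.+1.
    exact: alpha_max_ge_last.
  by congr (_`__ / psum _ _); rewrite nk.
have [v [vk vP]] := small_weights k e20 d0.
have eb : 0 <= e / 2 <= b by lra.
have [//|[I [r [s [ex sI tI sE far]]]]] := push_aside on Tb kn kT eb vP (leqnn k).
have small : total_weight I <= e / 2 * d`_0.
  by rewrite tI -vk; have [] := vP k (leqnn k).
have s0 : 0 < 2 - T.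
  rewrite ltNge; apply/negP => s0; suff : k.+1%:R * (2 - T) <= 0 by lra.
  exact: mulr_ge0_le0.
(* The three terms ensure the gap [T] after the first heavy request, the later gaps, and an offline
   delay of at most 1 in all. *)
pose h := Num.min (k.+1%:R * (2 - T) - 1) (Num.min ((2 - T) / 2) (m.+1%:R^-1 / 2)).
have h0 : 0 < h.
  by rewrite !lt_min !divr_gt0 ?invr_gt0 ?ltr0n//= andbT; lra.
have hk : h <= k.+1%:R * (2 - T) - 1 by rewrite ge_min lexx.
have hT : 2 * h <= 2 - T.
  suff : h <= (2 - T) / 2 by lra.
  by rewrite !ge_min lexx orbT.
have hm : m%:R * (2 * h) <= 1.
  have : h <= m.+1%:R^-1 / 2 by rewrite !ge_min lexx !orbT.
  have mi : m.+1%:R * m.+1%:R^-1 = 1 :> R by rewrite divff// pnatr_eq0.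
  have i0 : 0 <= m.+1%:R^-1 :> R by rewrite invr_ge0 ler0n.
  have m0 : 0 <= m%:R :> R by exact: ler0n.
  move: mi i0; rewrite -natr1; move: (_^-1) => u; nra.
have b0 : 0 <= b by lra.
have [|||//|dl] := duel_start on Tb (_ : (0 < k < n)%N) h0 hk _ pd _ eb ex sI small sE far.
- by rewrite k0.
- lra.
- by rewrite sd.
suff win i j : (i + j = m)%N -> duel ALG T k d (e / 2) h j -> beaten ALG n T b.
  by apply: (win m 0%N); rewrite ?addn0.
elim: i j => [|i IH] j ij dj.
  by rewrite add0n in ij; rewrite ij in dj; exact: (duel_end on T1 kmn sd pd b0 goodm dj).
have jm : (j < m)%N by clear -ij; lia.
have [//|] := duel_step on Tb kmn jm sd pd b0 h0 hT hm (goodj _ jm) dj.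
by apply: IH; clear -ij; lia.
Qed.

Lemma alpha1 : alpha R 1 = 1.
Proof.
apply/eqP; rewrite eq_le alpha_le1/=; apply: lb_le_inf (alpha_nonempty R 1) _.
move=> _ [d /= pd <-]; apply: le_trans (alpha_max_ge_last d).
rewrite psumS psum0 add0r divff//; apply/lt0r_neq0/nth_gt0 => //.
by rewrite size_tuple.
Qed.

End Value.

(** * The two ranges of [T] *)

Unset Implicit Arguments.

Theorem theorem2 (R : realType) (n : nat) (T : R) (hn : (2 <= n)%N) :
  (1 <= T <= 2 - 1 / (n%:R - 1) ->
     lambda n T = gamma n T /\
     gamma n T = alpha R (n - Num.truncn (1 / (2 - T)))%N) /\
  (2 - 1 / (n%:R - 1) <= T ->
     lambda n T = gamma n T /\ gamma n T = 1).
Proof.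
have n1 : 1 <= n%:R - 1 :> R by move: hn; rewrite -(ler_nat R); lra.
have inv0 : 0 < 1 / (n%:R - 1 : R) by rewrite divr_gt0//; lra.
have invK : (1 / (n%:R - 1)) * (n%:R - 1) = 1 :> R by rewrite mulfVK//; lra.
split=> [/andP[T1 T2]|T2].
  set k := Num.truncn _.
  have s0 : 0 < 2 - T by lra.
  have sK : 1 / (2 - T) * (2 - T) = 1 by rewrite mulfVK//; lra.
  have i0 : 0 <= 1 / (2 - T) by rewrite divr_ge0//; lra.
  have /andP[kl kr] := truncn_itv i0; rewrite -/k in kl kr.
  (* [T >= 1] gives [1 / (2 - T) >= 1], and the upper bound on [T] gives [1 / (2 - T) <= n - 1]. *)
  have k0 : (0 < k)%N by rewrite -ltnS -(ltr_nat R); nra.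
  have kn : (k < n)%N by rewrite -(ltr_nat R); nra.
  have kT : k%:R * (2 - T) <= 1 by nra.
  have kT' : 1 < k.+1%:R * (2 - T) by nra.
  have Tb : 1 <= T <= 2 by lra.
  have [|-> ->] // := value_eq (performance_lower_bound kn Tb kT).
  by move=> ALG e on e0; apply: competitive_upper_bound; rewrite ?k0.
have Tle1 : 1 / (n%:R - 1) <= 1 :> R by nra.
suff [-> ->] : lambda n T = 1 /\ gamma n T = 1 by [].
apply: value_eq => [|ALG e on e0].
  (* Instances with gaps at least [T] also have gaps at least [T'], which lies in the range of
     [performance_lower_bound]. Taking [n.-1] for [k] there yields the ratio [alpha R 1]. *)
  pose T' := Num.min T 2.
  have T'T : T' <= T by rewrite ge_min lexx.
  have T'E : T' = T \/ T' = 2 by rewrite /T'; case: leP; [left|right].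
  have Tb : 1 <= T' <= 2 by case: (leP T 2) T'E => h []; rewrite ?ge_min; lra.
  have kT : n.-1%:R * (2 - T') <= 1.
    have -> : n.-1%:R = n%:R - 1 :> R by rewrite -[in RHS](ltn_predK hn) -natr1; ring.
    by case: T'E => ->; nra.
  have kn : (n.-1 < n)%N by clear -hn; lia.
  have [ALG on low] := performance_lower_bound kn Tb kT; exists ALG => // I [iI sI gI].
  have := low I; rewrite (_ : n - n.-1 = 1)%N ?alpha1; last by clear -hn; lia.
  apply; split=> //; apply: sub_sorted gI => p q; lra.
(* No ratio exceeds 1, so that any instance will do. *)
have vI : all (@valid_request R) [:: Request 0 0 1].
  by rewrite /= /valid_request /= lexx ltr01 lerN10 ler01.
have iI : instance [:: Request 0 0 1 : request R] by rewrite /instance vI.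
exists [:: Request 0 0 1]; first by split=> //=; exact: ltnW.
have [onT _] := on; have := ratio_le1 vI (onT _ iI); lra.
Qed.
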